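(* Let $\mathbb{F}_q$ be a finite field such that $3 \mid (q-1)$, let $H$ be the unique index-$3$ subgroup of $\mathbb{F}_q^{\times}$, and let $\chi\colon H\to \mathbb{C}^{\times}$ be a nontrivial character. Let $\varphi_0,\varphi_1,\varphi_2$ be the three characters of $\mathbb{F}_q^{\times}$ extending $\chi$, let $G_i = G(\varphi_i)$ be their Gaussian sums, and let $T_0 = G_0+G_1+G_2$. Then the pair $(\mathbb{F}_q,\chi)$ has the nonvanishing minors property if and only if $G_i\neq G_j$ for some $i,j\in\{0,1,2\}$ and $T_0\neq 0$.
   Context: Let $p$ be the characteristic of $\mathbb{F}_q$, $q=p^m$. The canonical additive character is $\varepsilon\colon \mathbb{F}_q\to\mathbb{C}^{\times}$, $\varepsilon(x)=e^{2\pi i \operatorname{Tr}(x)/p}$, where $\operatorname{Tr}(x)=x+x^p+\cdots+x^{p^{m-1}}$ is the absolute trace $\mathbb{F}_q\to\mathbb{F}_p$; for $a \in \mathbb{F}_q$ put $\varepsilon_a(x)=\varepsilon(ax)$. These are all the additive characters of $\mathbb{F}_q$. Gaussian sums: for a character $\varphi\colon\mathbb{F}_q^{\times}\to\mathbb{C}^{\times}$, $G(\varphi)=\sum_{c\in\mathbb{F}_q^{\times}}\varphi(c)\varepsilon(c)$. Extensions: a character $\chi$ of the index-$3$ subgroup $H$ has exactly $3$ extensions $\varphi_0,\varphi_1,\varphi_2$ to characters of $\mathbb{F}_q^{\times}$, namely $\varphi_0\vartheta$ with $\vartheta$ ranging over the characters of $\mathbb{F}_q^{\times}$ trivial on $H$.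 Compressed Fourier transform ($\chi$ nontrivial): let $\mathbb{C}[\mathbb{F}_q]$ be the space of formal sums $f=\sum_{a\in\mathbb{F}_q}f_a a$ with $f_a\in\mathbb{C}$. Its Fourier transform is the function $\hat f$ on additive characters given by $\hat f(\psi)=\sum_{a\in\mathbb{F}_q}f_a\psi(a)$. An element $f$ is $\chi$-symmetric if $f_{ha}=\chi(h)f_a$ for all $h\in H$, $a\in\mathbb{F}_q$; the subspace of these is $\mathbb{C}[\mathbb{F}_q]^{\chi}$. Let $R$ and $S$ be (ordered) complete sets of representatives of the cosets of $H$ in $\mathbb{F}_q^{\times}$. The $(\chi,S)$-compressed Fourier transform is the linear isomorphism $\mathbb{C}[\mathbb{F}_q]^{\chi}\to\mathbb{C}^{\{\varepsilon_s : s\in S\}}$, $f\mapsto \hat f|_{\{\varepsilon_s : s\in S\}}$. Its matrix (with respect to a suitable basis of $\mathbb{C}[\mathbb{F}_q]^{\chi}$ indexed by $R$), the $(\chi,R,S)$-compressed Fourier matrix, is for $H$ of index $3$ the $3\times 3$ matrix with entries, for $r\in R$, $s\in S$, $$[\mathcal{F}_\chi]_{r,s}=\frac13\sum_{i=0}^{2}\overline{\varphi_i}(rs)\,G_i .$$ Nonvanishing minors property: an $n\times n$ complex matrix $(a_{i,j})$ has the nonvanishing minors property if for all nonempty $I,J\subseteq\{1,\dots,n\}$ with $|I|=|J|$, $\det (a_{i,j})_{i\in I,j\in J}\neq 0$. The pair $(\mathbb{F}_q,\chi)$ has the nonvanishing minors property if the $(\chi,R,S)$-compressed Fourier matrix does;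 this does not depend on the choice or ordering of $R$ and $S$. *)

(* Defs.v *)
From mathcomp Require Import all_boot all_order all_algebra all_fingroup.
From mathcomp Require Import complex.
From mathcomp Require Import reals trigo.

Set Implicit Arguments.
Unset Strict Implicit.
Unset Printing Implicit Defensive.

Import GRing.Theory Num.Theory.
Local Open Scope ring_scope.
Local Open Scope complex_scope.

(* Characters G -> C^x are represented by functions on the ambient group,
   of which only the values on G are relevant. *)
Definition is_character (R : realType) (gT : finGroupType) (G : {group gT})
    (f : gT -> R[i]) : Prop :=
  (forall x, x \in G -> f x != 0) /\
  {in G &, forall x y, f (x * y)%g = f x * f y}.

Definition nontrivial_character (R : realType) (gT : finGroupType)
    (G : {group gT}) (f : gT -> R[i]) : Prop :=
  exists2 x, x \in G & f x != 1.

Definition expi (R : realType) (t : R) : R[i] := cos t +i* sin t.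

Definition abs_trace (F : finFieldType) (p m : nat) (x : F) : F :=
  \sum_(j < m) x ^+ (p ^ j).

(* For y in the prime subfield of F, of characteristic p, this is the
   k < p such that y = k%:R. *)
Definition prime_field_repr (F : finFieldType) (p : nat) (y : F) : nat :=
  find (fun k : nat => k%:R == y) (iota 0 p).

Definition canonical_additive_character (R : realType) (F : finFieldType)
    (p m : nat) (x : F) : R[i] :=
  expi (2 * pi * (prime_field_repr p (abs_trace p m x))%:R / p%:R).

Definition gauss_sum (R : realType) (F : finFieldType) (p m : nat)
    (phi : {unit F} -> R[i]) : R[i] :=
  \sum_(c : {unit F}) phi c * canonical_additive_character R p m (val c).

(* phi lists three pairwise distinct extensions of chi to characters of the
   whole unit group; for H of index 3 these are all the extensions. *)
Definition are_three_extensions (R : realType) (F : finFieldType)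
    (H : {group {unit F}}) (chi : {unit F} -> R[i])
    (phi : 'I_3 -> {unit F} -> R[i]) : Prop :=
  [/\ forall i, is_character [set: {unit F}]%G (phi i),
      forall i, {in H, phi i =1 chi}
    & forall i j, phi i =1 phi j -> i = j].

Definition coset_representatives (gT : finGroupType) (H : {group gT}) (n : nat)
    (r : 'I_n -> gT) : Prop :=
  forall x : gT, exists! i : 'I_n, x \in (H :* r i)%g.

Definition compressed_fourier_matrix (R : realType) (F : finFieldType)
    (p m : nat) (phi : 'I_3 -> {unit F} -> R[i]) (r s : 'I_3 -> {unit F}) :
    'M[R[i]]_3 :=
  \matrix_(a < 3, b < 3)
    (3%:R^-1 * \sum_(i < 3) Num.conj (phi i (r a * s b)%g)
                            * gauss_sum p m (phi i)).

Definition nonvanishing_minors (K : fieldType) (n : nat) (A : 'M[K]_n) : Prop :=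
  forall (I J : {set 'I_n}) (eIJ : #|I| = #|J|), I != set0 ->
    \det (\matrix_(a < #|I|, b < #|I|)
            A (enum_val a) (enum_val (cast_ord eIJ b))) != 0.

(* Main.v *)
(* Writing [x = r a * s b], the matrix entries are [E x / 3] with
   [E x = \sum_i conj (phi i x) * G i]. The orthogonality relations between the
   three extensions and [G i * conj (G i) = q] give [M *m M^* = q%:M], so the
   entries of [M^-1] are conjugates of entries of [M], up to the factor [q].
   As the minors of order 2 are entries of the inverse up to a nonzero factor,
   all minors are nonzero as soon as all entries are.
   On [H], [E x] is [T0] up to a nonzero factor. Off [H], both [phi i x] and,
   if [E x = 0], the terms [conj (phi i x) * G i] are triples of complex numbers
   of equal norm with sum 0, that is, of the form [z, z w, z w^2] with [w] a
   primitive cube root of unity; then either the two roots [w] cancel and the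
   [G i] are all equal, or they do not and [T0 = 0]. *)
Require Import Defs.
From mathcomp Require Import all_boot all_order all_algebra all_fingroup.
From mathcomp Require Import complex.
From mathcomp Require Import reals trigo.
From mathcomp Require Import finfield ring.

Set Implicit Arguments.
Unset Strict Implicit.
Unset Printing Implicit Defensive.

Import Order.TTheory GRing.Theory Num.Theory.
Local Open Scope ring_scope.
Local Open Scope complex_scope.

(** * Minors of square matrices *)

Lemma nonvanishing_minors_entry (K : fieldType) (n : nat) (A : 'M[K]_n)
    (i j : 'I_n) :
  nonvanishing_minors A -> A i j != 0.
Proof.
move=> minA.
have eIJ : #|[set i]| = #|[set j]| by rewrite !cards1.
have iN0 : [set i] != set0 by apply/set0Pn; exists i; rewrite inE.
move: (minA _ _ eIJ iN0); set B := (X in \det X).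
have eqB a b : B a b = A i j.
  by rewrite mxE; congr (A _ _); apply/set1P; apply: enum_valP.
(* The size [#|[set i]|] becomes 1 only after [B] is generalized, since its body depends on that
   size. *)
clearbody B; move: B eqB.
by rewrite cards1 => B eqB; rewrite det_mx11 eqB.
Qed.

(* For sizes 1 and 2 a linear dependency between the rows of a minor extends by
   zero to a row vector [w] such that [w] or [w *m A] has a single nonzero
   entry, which forces an entry of [A] or of [invmx A] to vanish. *)
Lemma nonvanishing_minors3 (K : fieldType) (A : 'M[K]_3) :
  A \in unitmx -> (forall i j, A i j != 0) -> (forall i j, invmx A i j != 0) ->
  nonvanishing_minors A.
Proof.
move=> uA A_neq0 V_neq0 I J eIJ I_neq0; apply/negP => /det0P[v v_neq0 vB0].
pose w : 'rV[K]_3 := \row_i \sum_(a | enum_val a == i) v 0 a.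
have wE a : w 0 (enum_val a) = v 0 a.
  rewrite mxE (bigD1 a) //= big1 ?addr0 // => b /andP[/eqP/enum_val_inj ->].
  by rewrite eqxx.
have w_out i : i \notin I -> w 0 i = 0.
  move=> iNI; rewrite mxE big1 // => a /eqP ai.
  by case/negP: iNI; rewrite -ai enum_valP.
have w_neq0 : w != 0.
  apply: contra_neq v_neq0 => w0; apply/rowP => a.
  by rewrite -wE w0 !mxE.
have wA0 j : j \in J -> (w *m A) 0 j = 0.
  move=> jJ; pose b := cast_ord (esym eIJ) (enum_rank_in jJ j).
  have := congr1 (fun u : 'rV_#|I| => u 0 b) vB0; rewrite [RHS]mxE => vBb0.
  rewrite -[RHS]vBb0 !mxE.
  rewrite (bigID [in I]) /= [X in _ + X]big1 ?addr0; last first.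
    by move=> i /w_out ->; rewrite mul0r.
  rewrite big_enum_val /=; apply: eq_bigr => a _; rewrite mxE wE.
  by rewrite cast_ordKV enum_rankK_in.
clear vB0 v_neq0.
have wAV : w = w *m A *m invmx A by rewrite mulmxK.
have wA_neq0 : w *m A != 0.
  by apply: contra_neq w_neq0 => wA_eq0; rewrite wAV wA_eq0 mul0mx.
have cards : (#|I| + #|~: I| = 3)%N by rewrite cardsC card_ord.
have cardsJ : (#|J| + #|~: J| = 3)%N by rewrite cardsC card_ord.
have : (0 < #|I|)%N by rewrite card_gt0.
case cI: #|I| => [//|[|[|k]]] _.
- have /cards1P[i eI] : #|I| == 1%N by rewrite cI.
  have /card_gt0P[j jJ] : (0 < #|J|)%N by rewrite -eIJ cI.
  have := wA0 _ jJ; rewrite mxE (bigD1 i) //= big1 ?addr0; last first.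
    by move=> k ki; rewrite w_out ?mul0r // eI inE.
  move/eqP; rewrite mulf_eq0 (negPf (A_neq0 i j)) orbF => /eqP wi.
  case/eqP: w_neq0; apply/rowP => k; rewrite [RHS]mxE.
  by have [->//|ki] := eqVneq k i; rewrite w_out // eI inE.
- have /cards1P[j eJ] : #|~: J| == 1%N.
    by rewrite -(eqn_add2l #|J|) cardsJ -eIJ cI.
  have /card_gt0P[i iI] : (0 < #|~: I|)%N.
    by rewrite -(ltn_add2l #|I|) addn0 cards cI.
  have wA_out k : k != j -> (w *m A) 0 k = 0.
    by move=> kj; apply: wA0; rewrite -[J]setCK eJ !inE.
  have : w 0 i = 0 by apply: w_out; rewrite -in_setC.
  rewrite wAV mxE (bigD1 j) //= big1 ?addr0; last first.
    by move=> k kj; rewrite wA_out ?mul0r.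
  move/eqP; rewrite mulf_eq0 (negPf (V_neq0 j i)) orbF => /eqP wj.
  case/eqP: wA_neq0; apply/rowP => k; rewrite [RHS]mxE.
  by have [->//|kj] := eqVneq k j; rewrite wA_out.
(* In size 3, [J] contains every column, so [w *m A = 0], against the invertibility of [A]. *)
- have /eqP JT : J == setT.
    by rewrite eqEcard subsetT cardsT card_ord /= -eIJ cI.
  by case/eqP: wA_neq0; apply/rowP => j; rewrite [RHS]mxE wA0 // JT inE.
Qed.

(* Conjugating [z0 + z1 + z2 = 0] and multiplying by [z0 * z1 * z2] gives
   [z0 * z1 + z1 * z2 + z2 * z0 = 0]. *)
Lemma equal_norm_sum0 (C : numClosedFieldType) (q : C) (z : 'I_3 -> C) :
  q != 0 -> (forall i, z i * Num.conj (z i) = q) -> \sum_i z i = 0 ->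
  z ord0 ^+ 2 + z ord0 * z (inord 1) + z (inord 1) ^+ 2 = 0 /\
  z (inord 2) = - (z ord0 + z (inord 1)).
Proof.
move=> q_neq0 zq.
have -> : \sum_i z i = z ord0 + z (inord 1) + z (inord 2).
  rewrite !big_ord_recl big_ord0 addr0 addrA.
  by congr (_ + z _ + z _); apply: val_inj; rewrite /= inordK.
move=> z0; have z2E : z (inord 2) = - (z ord0 + z (inord 1)).
  by apply/eqP; rewrite -addr_eq0 addrC z0.
split=> //; move/(congr1 Num.conj): (z0); rewrite !rmorphD rmorph0 /=.
move: (zq ord0) (zq (inord 1)) (zq (inord 2)); rewrite z2E.
move: (z ord0) (z (inord 1)) => a b.
move: (Num.conj a) (Num.conj b) (Num.conj (- (a + b))) => a' b' c' aq bq cq s0.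
apply: (mulfI q_neq0); rewrite mulr0.
transitivity (a * b * (a + b) * (a' + b' + c')); last by rewrite s0 mulr0.
have -> : a * b * (a + b) * (a' + b' + c') =
  b * (a + b) * (a * a') + a * (a + b) * (b * b') - a * b * (- (a + b) * c').
  by ring.
by rewrite aq bq cq; ring.
Qed.

(** * Values and sums of characters of a finite group *)

Lemma mul_conj_unity_root (C : numClosedFieldType) (n : nat) (z : C) :
  (0 < n)%N -> z ^+ n = 1 -> z * Num.conj z = 1.
Proof.
move=> n_gt0 zn1; rewrite -normCK.
have /eqP : `|z| ^+ n = 1 by rewrite -normrX zn1 normr1.
by rewrite pexpr_eq1 // => /eqP ->; rewrite expr1n.
Qed.

Section Characters.

Variables (R : realType) (gT : finGroupType) (G : {group gT}).
Implicit Types f : gT -> R[i].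

Lemma character1 f : is_character G f -> f 1%g = 1.
Proof.
case=> f_neq0 fM; apply: (mulfI (f_neq0 _ (group1 G))).
by rewrite -fM ?group1 // mulg1 mulr1.
Qed.

Lemma characterX f x n : is_character G f -> x \in G -> f (x ^+ n)%g = f x ^+ n.
Proof.
move=> fG xG; elim: n => [|n IHn]; first by rewrite expg0 expr0 character1.
by rewrite expgS exprS fG.2 ?groupX // IHn.
Qed.

Lemma character_mul_conj f x :
  is_character G f -> x \in G -> f x * Num.conj (f x) = 1.
Proof.
move=> fG xG; apply: (@mul_conj_unity_root _ #[x]%g); rewrite ?order_gt0 //.
by rewrite -characterX // expg_order character1.
Qed.

(** Translation by an element [y] with [f y != 1] permutes [G] and multiplies the sum by [f y]. *)
Lemma sum_character f :
  is_character G f -> nontrivial_character G f -> \sum_(x in G) f x = 0.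
Proof.
move=> fG [y yG fy]; have fy' : f y - 1 != 0 by rewrite subr_eq0.
apply: (mulfI fy'); rewrite mulr0 mulrBl mul1r mulr_sumr.
apply/eqP; rewrite subr_eq0; apply/eqP; symmetry.
rewrite (reindex_inj (mulgI y)) /=; apply: eq_big => x.
  by rewrite groupMl.
by rewrite groupMl // => xG; rewrite fG.2.
Qed.

End Characters.

(** * Gaussian sums for an abstract nontrivial additive character *)

Lemma sum_unit (V : nmodType) (F : finFieldType) (f : F -> V) :
  \sum_x f x = f 0 + \sum_(u : {unit F}) f (val u).
Proof.
rewrite (bigD1 0) //=; congr (_ + _).
(* [insubd] inverts [val] away from 0; its default value is reached only at 0, which this sum
   excludes. *)
rewrite (reindex_onto (val : {unit F} -> F)
  (fun x => insubd (1%g : {unit F}) x)) /=; last first.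
  by move=> x x0; rewrite val_insubd unitfE x0.
by apply: eq_bigl => u; rewrite valKd eqxx andbT -unitfE (valP u).
Qed.

Section GaussSum.

Variables (R : realType) (F : finFieldType) (p : nat).
Variables (phi : {unit F} -> R[i]) (eps : F -> R[i]).
Hypothesis p_char : p \in [pchar F].
Hypothesis phi_char : is_character [set: {unit F}]%G phi.
Hypothesis phi_nt : nontrivial_character [set: {unit F}]%G phi.
Hypothesis epsD : {morph eps : x y / x + y >-> x * y}.
Hypothesis eps0 : eps 0 = 1.
Hypothesis eps_nt : exists x, eps x != 1.

(** In characteristic [p] the values of [eps] are [p]-th roots of unity, whose conjugates are their
    inverses. *)
Lemma conj_additive_character x : Num.conj (eps x) = eps (- x).
Proof.
have epsX n : eps (x *+ n) = eps x ^+ n.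
  by elim: n => [|n IHn]; rewrite ?mulr0n // mulrS exprS epsD IHn.
have epsK : eps x * Num.conj (eps x) = 1.
  apply: (@mul_conj_unity_root _ p).
    exact/prime_gt0/(pcharf_prime p_char).
  by rewrite -epsX (mulrn_pchar p_char).
have x_neq0 : eps x != 0.
  by apply: contra_eq_neq epsK => ->; rewrite mul0r eq_sym oner_eq0.
by apply: (mulfI x_neq0); rewrite epsK -epsD subrr eps0.
Qed.

Lemma sum_additive_character a :
  \sum_x eps (a * x) = #|F|%:R * (a == 0)%:R.
Proof.
have [->|a_neq0] := eqVneq a 0.
  by rewrite mulr1 -sumr_const; apply: eq_bigr => x _; rewrite mul0r eps0.
rewrite mulr0; have [y eps_y] := eps_nt.
have eps_y' : eps y - 1 != 0 by rewrite subr_eq0.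
apply: (mulfI eps_y'); rewrite mulr0 mulrBl mul1r mulr_sumr.
apply/eqP; rewrite subr_eq0; apply/eqP; symmetry.
rewrite (reindex_inj (addrI (a^-1 * y))) /=; apply: eq_bigr => x _.
by rewrite mulrDr mulVKf // epsD.
Qed.

(* Substituting [c = e * d] in the double sum over [(c, d)] leaves the sum over
   [d] of the additive character [d |-> eps ((e - 1) * d)]. *)
Lemma gauss_sum_mul_conj :
  (\sum_c phi c * eps (val c)) * Num.conj (\sum_c phi c * eps (val c)) =
  #|F|%:R.
Proof.
have term (d e : {unit F}) :
    phi (e * d)%g * eps (val (e * d)%g) * Num.conj (phi d * eps (val d)) =
    phi e * eps ((val e - 1) * val d).
  rewrite rmorphM /= conj_additive_character phi_char.2 ?inE //.
  rewrite mulrBl mul1r epsD.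
  transitivity (phi e * (eps (val e * val d) * eps (- val d)) *
                (phi d * Num.conj (phi d))); first by ring.
  by rewrite (character_mul_conj phi_char) ?inE // mulr1.
rewrite rmorph_sum mulr_sumr /=.
transitivity
  (\sum_(d : {unit F}) \sum_(e : {unit F}) phi e * eps ((val e - 1) * val d)).
  apply: eq_bigr => d _; rewrite mulr_suml (reindex_inj (mulIg d)) /=.
  by apply: eq_bigr => e _; apply: term.
rewrite exchange_big /=.
(* Adding the term [phi e] at 0 completes this to a sum over the field, which is [#|F| * phi e] if
   [e = 1] and 0 otherwise. The corrections [- phi e] then sum to 0 over [e], as [phi] is
   nontrivial. *)
have inner (e : {unit F}) :
    \sum_(d : {unit F}) phi e * eps ((val e - 1) * val d) =
    #|F|%:R * ((e == 1%g)%:R * phi e) - phi e.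
  rewrite -mulr_sumr; have := sum_additive_character (val e - 1).
  rewrite sum_unit mulr0 eps0 subr_eq0.
  move=> /(canRL (addKr _)) ->.
  by rewrite (inj_eq val_inj e 1%g); ring.
under eq_bigr do rewrite inner.
rewrite big_split /= sumrN.
have := sum_character phi_char phi_nt; rewrite big_set /= => ->.
rewrite subr0 -mulr_sumr (bigD1 1%g) //= big1 ?addr0; last first.
  by move=> e /negPf ->; rewrite mul0r.
by rewrite eqxx mul1r (character1 phi_char) mulr1.
Qed.

End GaussSum.

(** * The complex exponential on the unit circle *)

Lemma expiD (R : realType) (x y : R) : expi (x + y) = expi x * expi y.
Proof.
apply/eqP; rewrite eq_complex /= cosD sinD eqxx /=; apply/eqP; ring.
Qed.

Lemma expi0 (R : realType) : expi (0 : R) = 1.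
Proof. by rewrite /expi cos0 sin0. Qed.

Lemma expi_mulrn (R : realType) (x : R) (n : nat) : expi (x *+ n) = expi x ^+ n.
Proof.
elim: n => [|n IHn]; first by rewrite mulr0n expi0.
by rewrite mulrS exprS expiD IHn.
Qed.

(** The real part is [1 - 2 sin (t / 2) ^ 2], and [t / 2] lies strictly between 0 and [pi]. *)
Lemma expi_neq1 (R : realType) (t : R) : 0 < t < 2 * pi -> expi t != 1.
Proof.
move=> /andP[t_gt0 t_lt]; rewrite eq_complex /= negb_and; apply/orP; left.
have t2 : 0 < t / 2 < pi by rewrite divr_gt0 //= ltr_pdivrMr // mulrC.
have /lt0r_neq0 sin_neq0 := sin_gt0_pi t2.
have -> : t = (t / 2) *+ 2 by rewrite -mulr_natr divfK ?pnatr_eq0.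
rewrite cos_mulr2n cos2sin2.
apply: contra_neq sin_neq0 => cos1; apply/eqP; rewrite -sqrf_eq0.
rewrite -[_ == 0](mulrn_eq0 _ 2); apply/eqP.
move/eqP: cos1; rewrite -subr_eq0 -oppr_eq0 => /eqP <-; ring.
Qed.

(** * The absolute trace and the canonical additive character *)

Section AdditiveCharacter.

Variables (R : realType) (F : finFieldType) (p m : nat).
Hypothesis p_char : p \in [pchar F].
Hypothesis card_F : #|F| = (p ^ m)%N.

Lemma pnat_pcharX j : [pchar F].-nat (p ^ j)%N.
Proof. by rewrite pnatX (pnatE _ (pcharf_prime p_char)) p_char. Qed.

Lemma abs_traceD x y :
  abs_trace p m (x + y) = abs_trace p m x + abs_trace p m y :> F.
Proof.
rewrite /abs_trace -big_split /=; apply: eq_bigr => j _.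
by rewrite exprDn_pchar // pnat_pcharX.
Qed.

(** Frobenius moves each term of the trace to the next one, and the last to [x ^+ (p ^ m) = x], the
    first. *)
Lemma abs_trace_frobenius (x : F) : abs_trace p m x ^+ p = abs_trace p m x.
Proof.
have frobD : {morph (fun y : F => y ^+ p) : y z / y + z}.
  by move=> y z; apply: exprDn_pchar; apply: (pnat_pcharX 1).
have frob0 : (0 : F) ^+ p = 0.
  by rewrite expr0n eqn0Ngt prime_gt0 // (pcharf_prime p_char).
rewrite /abs_trace (big_morph _ frobD frob0).
transitivity (\sum_(j < m) x ^+ (p ^ j.+1)).
  by apply: eq_bigr => j _; rewrite -exprM expnSr.
have : \sum_(j < m.+1) x ^+ (p ^ j) =
    x ^+ (p ^ 0) + \sum_(j < m) x ^+ (p ^ j.+1).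
  exact: big_ord_recl.
rewrite big_ord_recr /= expn0 expr1 -card_F expf_card addrC.
by move=> /addrI ->.
Qed.

(** If [y] were no [k%:R] with [k < p], then it and these [p] elements would be [p.+1] distinct
    roots of ['X^p - 'X]. So the search never ends at its default value [p]. *)
Lemma prime_field_reprP (y : F) : y ^+ p = y ->
  (prime_field_repr p y < p)%N /\ (prime_field_repr p y)%:R = y.
Proof.
move=> yp; have p_gt1 : (1 < p)%N by rewrite prime_gt1 // (pcharf_prime p_char).
have has_y : has (fun k : nat => k%:R == y) (iota 0 p).
  apply: contraT => /hasPn no_y.
  pose rs := y :: [seq (k%:R : F) | k <- iota 0 p].
  have sizeP : size ('X^p - 'X : {poly F}) = p.+1.
    by rewrite size_polyDl size_polyXn // size_polyN size_polyX ltnS.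
  have P_neq0 : 'X^p - 'X != 0 :> {poly F} by rewrite -size_poly_eq0 sizeP.
  have natF (k : nat) : (k%:R : F) ^+ p = k%:R.
    exact: (pFrobenius_aut_nat p_char).
  have rootP : all (root ('X^p - 'X : {poly F})) rs.
    apply/allP => z; rewrite inE rootE !hornerE subr_eq0.
    by case/orP=> [/eqP ->|/mapP[k _ ->]]; rewrite ?yp ?natF.
  have uniq_rs : uniq rs.
    rewrite /= map_inj_in_uniq ?iota_uniq ?andbT.
      by apply/mapP => -[k /no_y /negP kNy y_k]; apply: kNy; rewrite -y_k.
    move=> k l; rewrite !mem_iota /= !add0n.
    wlog le_kl : k l / (k <= l)%N => [IH|] k_lt l_lt kl.
      case/orP: (leq_total k l) => [le_kl|le_lk]; first exact: IH.
      by apply/esym/IH.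
    apply/eqP; rewrite eqn_leq le_kl /= -subn_eq0 eqn0Ngt.
    have : (p %| l - k)%N by rewrite (dvdn_pcharf p_char) natrB // kl subrr.
    apply: contraL => lk_gt0.
    by rewrite gtnNdvd // (leq_ltn_trans (leq_subr k l)).
  have := max_poly_roots P_neq0 rootP uniq_rs.
  by rewrite sizeP /= size_map size_iota ltnn.
have lt_p : (prime_field_repr p y < p)%N.
  by move: has_y; rewrite has_find size_iota.
split=> //; have /eqP := nth_find 0%N has_y.
by rewrite nth_iota.
Qed.

Local Notation tr x := (prime_field_repr p (abs_trace p m x)).
Local Notation zeta := (expi (2 * pi / p%:R) : R[i]).
Local Notation eps := (canonical_additive_character R p m).

Lemma canonical_additive_characterE (x : F) : eps x = zeta ^+ tr x.
Proof.
by rewrite -expi_mulrn -(mulr_natr _ (tr x)) -mulrAC.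
Qed.

(** Equality of naturals in [F] is congruence modulo [p], and [zeta ^+ p = 1]. Hence [eps] does not
    depend on the representative of the trace. *)
Lemma expi_period_pchar (j k : nat) :
  j%:R = k%:R :> F -> zeta ^+ j = zeta ^+ k.
Proof.
have zeta_p : zeta ^+ p = 1.
  rewrite -expi_mulrn -(mulr_natr (2 * pi / p%:R) p) divfK.
    by rewrite mulr_natl /expi cos2pi sin2pi.
  by rewrite pnatr_eq0 -lt0n prime_gt0 // (pcharf_prime p_char).
wlog le_jk : j k / (j <= k)%N => [IH|] jk.
  by case/orP: (leq_total j k) => ?; [|symmetry]; apply: IH.
have /dvdnP[d kE] : (p %| k - j)%N.
  by rewrite (dvdn_pcharf p_char) natrB // jk subrr.
by rewrite -(subnK le_jk) kE exprD mulnC exprM zeta_p expr1n mul1r.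
Qed.

Lemma abs_trace_reprP (x : F) : (tr x < p)%N /\ (tr x)%:R = abs_trace p m x.
Proof. exact/prime_field_reprP/abs_trace_frobenius. Qed.

Lemma canonical_additive_characterD :
  {morph (eps : F -> R[i]) : x y / x + y >-> x * y}.
Proof.
move=> x y; rewrite !canonical_additive_characterE -exprD.
by apply: expi_period_pchar; rewrite natrD !(abs_trace_reprP _).2 abs_traceD.
Qed.

(** The trace is given by a polynomial of degree less than [#|F|], nonzero because [j = 0] alone
    contributes to its coefficient of ['X]; it cannot vanish on all of [F]. *)
Lemma abs_trace_neq0 : exists x : F, abs_trace p m x != 0.
Proof.
have p_gt1 : (1 < p)%N by rewrite prime_gt1 // (pcharf_prime p_char).
have m_gt0 : (0 < m)%N.
  rewrite lt0n; apply: contraTneq (finNzRing_gt1 F) => m0.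
  by rewrite card_F m0.
pose P : {poly F} := \sum_(j < m) 'X^(p ^ j).
have PE x : P.[x] = abs_trace p m x.
  by rewrite horner_sum; apply: eq_bigr => j _; rewrite hornerXn.
have P1 : P`_1 = 1.
  rewrite coef_sum (bigD1 (Ordinal m_gt0)) //= coefXn expn0 eqxx.
  rewrite big1 ?addr0 // => j; rewrite -val_eqE /= => j0.
  by rewrite coefXn -{1}(expn0 p) eqn_exp2l // eq_sym (negPf j0).
have P_neq0 : P != 0.
  by apply: contra_eq_neq P1 => ->; rewrite coef0 eq_sym oner_eq0.
have sizeP : (size P <= #|F|)%N.
  rewrite card_F; apply: (leq_trans (size_sum _ _ _)).
  by apply/bigmax_leqP => j _; rewrite size_polyXn ltn_exp2l.
apply/existsP; apply: contraTT sizeP => /existsPn tr0.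
rewrite -ltnNge cardE; apply: max_poly_roots; rewrite ?enum_uniq //.
apply/allP => x _; rewrite rootE PE; exact/negPn/tr0.
Qed.

Lemma canonical_additive_character0 : eps (0 : F) = 1.
Proof.
rewrite canonical_additive_characterE -(expr0 zeta); apply: expi_period_pchar.
rewrite (abs_trace_reprP _).2; apply: (addrI (abs_trace p m 0)).
by rewrite -abs_traceD !addr0.
Qed.

Lemma canonical_additive_character_nontrivial : exists x : F, eps x != 1.
Proof.
have [x tr_neq0] := abs_trace_neq0; exists x.
have [tr_lt trE] := abs_trace_reprP x.
have p_gt0 : (0 < p)%N by apply: leq_ltn_trans tr_lt.
have tr_gt0 : (0 < tr x)%N.
  by rewrite lt0n; apply: contra_neq tr_neq0 => tr0; rewrite -trE tr0.
(* As [0 < tr x < p], the angle lies strictly between 0 and [2 * pi]. *)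
apply: expi_neq1; rewrite divr_gt0 ?mulr_gt0 ?pi_gt0 ?ltr0n //=.
by rewrite ltr_pdivrMr ?ltr0n // ltr_pM2l ?ltr_nat // mulr_gt0 ?pi_gt0.
Qed.

Lemma gauss_sum_norm (phi : {unit F} -> R[i]) :
  is_character [set: {unit F}]%G phi ->
  nontrivial_character [set: {unit F}]%G phi ->
  gauss_sum p m phi * Num.conj (gauss_sum p m phi) = #|F|%:R.
Proof.
move=> phi_char phi_nt; apply: (gauss_sum_mul_conj p_char) => //.
- exact: canonical_additive_characterD.
- exact: canonical_additive_character0.
- exact: canonical_additive_character_nontrivial.
Qed.

End AdditiveCharacter.

(** * Representatives of the cosets of a subgroup *)

Section CosetRepresentatives.

Variables (R : realType) (gT : finGroupType) (H : {group gT}) (n : nat).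
Variable r : 'I_n -> gT.
Hypothesis r_reps : coset_representatives H r.

(** The index [a] is that of the coset of [y^-1]. With [y = s b], each column of the Fourier matrix
    has exactly one entry whose argument lies in [H]. *)
Lemma coset_representatives_mul (y : gT) :
  exists a, forall b, (r b * y \in H)%g = (b == a).
Proof.
have [a [ya uniq_a]] := r_reps y^-1%g.
have memE b : (r b * y \in H)%g = (y^-1%g \in H :* r b)%g.
  by rewrite mem_rcoset -invMg groupV.
exists a => b; rewrite memE.
by apply/idP/eqP => [/uniq_a ->|->].
Qed.

(** Since [f] is constant on cosets, its sum over the group, which is 0, is [#|H|] times the sum
    over representatives. *)
Lemma sum_coset_representatives (f : gT -> R[i]) :
  is_character [set: gT]%G f -> nontrivial_character [set: gT]%G f ->
  {in H, forall x, f x = 1} -> \sum_a f (r a) = 0.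
Proof.
move=> f_char f_nt fH.
have sumE : \sum_x f x = #|H|%:R * \sum_a f (r a).
  transitivity (\sum_x \sum_(a | x \in (H :* r a)%g) f (r a)).
    apply: eq_bigr => x _; have [a [xa uniq_a]] := r_reps x.
    rewrite (bigD1 a) //= big1 ?addr0; last first.
      by move=> b /andP[/uniq_a -> /eqP].
    have [h hH ->] := rcosetP xa.
    by rewrite f_char.2 ?inE // fH // mul1r.
  rewrite (exchange_big_dep xpredT) //= mulr_sumr; apply: eq_bigr => a _.
  by rewrite sumr_const card_rcoset mulr_natl.
have := sum_character f_char f_nt; rewrite big_set /= sumE => /eqP.
by rewrite mulf_eq0 pnatr_eq0 -[_ == _]negbK -lt0n cardG_gt0 => /eqP.
Qed.

End CosetRepresentatives.

(** * Orthogonality relations between the three extensions *)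

Section Extensions.

Variables (R : realType) (gT : finGroupType) (H : {group gT}).
Variables (chi : gT -> R[i]) (phi : 'I_3 -> gT -> R[i]).
Hypothesis phi_char : forall i, is_character [set: gT]%G (phi i).
Hypothesis phi_chi : forall i, {in H, phi i =1 chi}.
Hypothesis phi_inj : forall i j, phi i =1 phi j -> i = j.

Local Notation phi_mx r := (\matrix_(a < 3, i < 3) phi i (r a)).
Local Notation conj_phi_mx r := (\matrix_(a < 3, i < 3) Num.conj (phi i (r a))).

Lemma extensionM i x y : phi i (x * y)%g = phi i x * phi i y.
Proof. by rewrite (phi_char i).2 ?inE. Qed.

Lemma extension_mul_conj i x : phi i x * Num.conj (phi i x) = 1.
Proof. by rewrite (character_mul_conj (phi_char i)) ?inE. Qed.

Lemma extension_neq0 i x : phi i x != 0.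
Proof. by apply: (phi_char i).1; rewrite inE. Qed.

(** For [i != j], the product of [phi j] and the conjugate of [phi i] is a nontrivial character,
    trivial on [H] because both extend [chi]. *)
Lemma phi_mx_row_orthogonal (r : 'I_3 -> gT) : coset_representatives H r ->
  (conj_phi_mx r)^T *m phi_mx r = 3%:R%:M.
Proof.
move=> r_reps; apply/matrixP => i j; rewrite !mxE.
under eq_bigr do rewrite !mxE mulrC.
have [<-|i_j] := eqVneq i j.
  under eq_bigr do rewrite extension_mul_conj.
  by rewrite sumr_const card_ord.
apply: (sum_coset_representatives r_reps
  (f := fun x => phi j x * Num.conj (phi i x))).
- split=> [x _|x y _ _].
    by rewrite mulf_neq0 ?conjC_eq0 ?extension_neq0.
  by rewrite !extensionM rmorphM mulrACA.
- have /existsP[y y_neq] : [exists y, phi i y != phi j y].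
    apply: contraNT i_j => /existsPn eq_ij; apply/eqP/phi_inj => y.
    by apply/eqP/negPn/eq_ij.
  exists y; rewrite ?inE //; apply: contra_neq y_neq => y1.
  by rewrite -[LHS]mul1r -y1 -mulrA [_^* * _]mulrC extension_mul_conj mulr1.
- by move=> x xH; rewrite !phi_chi // -(phi_chi i) // extension_mul_conj.
Qed.

(** Up to the factor 3, the transposed row relations exhibit a left inverse of a square matrix,
    which is also a right inverse. *)
Lemma phi_mx_col_orthogonal (r : 'I_3 -> gT) : coset_representatives H r ->
  conj_phi_mx r *m (phi_mx r)^T = 3%:R%:M.
Proof.
move=> r_reps; have n3 : 3%:R != 0 :> R[i] by rewrite pnatr_eq0.
have /(congr1 trmx) := phi_mx_row_orthogonal r_reps.
rewrite trmx_mul trmxK tr_scalar_mx => row3.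
have /mulmx1C : (3%:R^-1 *: (phi_mx r)^T) *m conj_phi_mx r = 1%:M.
  by rewrite -scalemxAl row3 scale_scalar_mx mulVf.
rewrite -scalemxAr => /(congr1 ( *:%R 3%:R)).
by rewrite scalerA divff // scale1r scale_scalar_mx mulr1.
Qed.

Lemma sum_conj_extensions (r : 'I_3 -> gT) x :
  coset_representatives H r -> x \notin H -> \sum_i Num.conj (phi i x) = 0.
Proof.
move=> r_reps xNH.
(* [r a] represents [H] and [r c] the coset of [x], so [a] and [c] differ and the column relation at
   [(a, c)] has right side 0. Its terms share the factor [conj (chi (r a))], and [r c] differs from
   [x] by an element of [H]. *)
have [a aP] := coset_representatives_mul r_reps 1%g.
have [c cP] := coset_representatives_mul r_reps x^-1%g.
have raH : r a \in H by rewrite -[r a]mulg1 aP.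
have c_a : c == a = false.
  apply: contraNF xNH => /eqP ca; have := cP c; rewrite eqxx ca.
  by rewrite groupMl ?groupV.
have := congr1 (fun A : 'M_3 => A a c) (phi_mx_col_orthogonal r_reps).
rewrite !mxE eq_sym c_a mulr0n.
under eq_bigr do rewrite !mxE phi_chi //.
rewrite -mulr_sumr => /eqP; rewrite mulf_eq0 conjC_eq0 -(phi_chi ord0) //.
rewrite (negPf (extension_neq0 _ _)) /= => /eqP sum0.
have xE : x = ((r c * x^-1)^-1 * r c)%g by rewrite invMg invgK mulgKV.
have hH : ((r c * x^-1)^-1)%g \in H by rewrite groupV cP.
rewrite -rmorph_sum /= xE.
under eq_bigr do rewrite extensionM phi_chi //.
by rewrite -mulr_sumr sum0 mulr0 rmorph0.
Qed.

(** * Sums twisted by numbers of equal norm, and the matrix they form *)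

Variables (q : R[i]) (G : 'I_3 -> R[i]).
Hypothesis q_neq0 : q != 0.
Hypothesis G_norm : forall i, G i * Num.conj (G i) = q.

Lemma twisted_sum_neq0 (r : 'I_3 -> gT) x : coset_representatives H r ->
  (exists i j, G i != G j) -> \sum_i G i != 0 ->
  \sum_i Num.conj (phi i x) * G i != 0.
Proof.
move=> r_reps G_neq T_neq0; have [xH|xNH] := boolP (x \in H).
  under eq_bigr do rewrite phi_chi //.
  by rewrite -mulr_sumr mulf_neq0 // conjC_eq0 -(phi_chi ord0) ?extension_neq0.
pose u i := Num.conj (phi i x).
have u_norm i : u i * Num.conj (u i) = 1.
  by rewrite /u conjCK mulrC extension_mul_conj.
have u_neq0 i : u i != 0 by rewrite conjC_eq0 extension_neq0.
have z_norm i : u i * G i * Num.conj (u i * G i) = q.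
  by rewrite rmorphM mulrACA u_norm G_norm mul1r.
have [u01 u2] :=
  equal_norm_sum0 (oner_neq0 _) u_norm (sum_conj_extensions r_reps xNH).
apply/negP => /eqP /(equal_norm_sum0 q_neq0 z_norm)[z01 z2].
have split3 (P : 'I_3 -> Prop) :
    P ord0 -> P (inord 1) -> P (inord 2) -> forall i, P i.
  move=> P0 P1 P2 [[|[|[|//]]] lti].
  - by have -> : Ordinal lti = ord0 by apply: val_inj.
  - by have -> : Ordinal lti = inord 1 by apply: val_inj; rewrite /= inordK.
  - by have -> : Ordinal lti = inord 2 by apply: val_inj; rewrite /= inordK.
have TE : \sum_i G i = G ord0 + G (inord 1) + G (inord 2).
  rewrite !big_ord_recl big_ord0 addr0 addrA.
  by congr (_ + G _ + G _); apply: val_inj; rewrite /= inordK.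
have u2_neq0 := u_neq0 (inord 2).
(* This is the quadratic relation for the [u i * G i] minus [G (inord 1) ^+ 2] times the one for the
   [u i]. The factor that vanishes tells whether the cube roots of unity behind the two triples are
   equal or inverse to each other. *)
have : u ord0 * (G ord0 - G (inord 1)) *
    (u ord0 * (G ord0 + G (inord 1)) + u (inord 1) * G (inord 1)) = 0.
  transitivity ((u ord0 * G ord0) ^+ 2 +
    u ord0 * G ord0 * (u (inord 1) * G (inord 1)) +
    (u (inord 1) * G (inord 1)) ^+ 2 - G (inord 1) ^+ 2 *
    (u ord0 ^+ 2 + u ord0 * u (inord 1) + u (inord 1) ^+ 2)); first by ring.
  by rewrite z01 u01 mulr0 subr0.
move/eqP; rewrite !mulf_eq0 (negPf (u_neq0 _)) /= subr_eq0 => /orP[] /eqP.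
  move=> G01; have G20 : G (inord 2) = G ord0.
    by apply: (mulfI u2_neq0); rewrite z2 u2 -G01; ring.
  have GE : forall i, G i = G ord0 by apply: split3.
  by case: G_neq => i [j]; rewrite !GE eqxx.
move=> uG; case/eqP: T_neq0; rewrite TE.
apply: (mulfI (mulf_neq0 u2_neq0 (u_neq0 ord0))); rewrite mulr0.
(* Each summand contains an expression known to vanish: the second factor above (twice), the sum of
   the [u i * G i], and the quadratic relation for [u]. The coefficient [- (u ord0 + u (inord 1))]
   is [u (inord 2)]. *)
transitivity (- (u ord0 + u (inord 1)) *
  (u ord0 * (G ord0 + G (inord 1)) + u (inord 1) * G (inord 1)) +
  u ord0 * (u (inord 2) * G (inord 2) +
    (u ord0 * G ord0 + u (inord 1) * G (inord 1))) -
  u ord0 * (u ord0 * (G ord0 + G (inord 1)) + u (inord 1) * G (inord 1)) +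
  G (inord 1) * (u ord0 ^+ 2 + u ord0 * u (inord 1) + u (inord 1) ^+ 2)).
  by rewrite u2; ring.
by rewrite uG z2 u01; ring.
Qed.

(** [M] is, up to a scalar, a diagonal matrix of the [G i] between two conjugated character tables.
    In the product with its adjoint the tables cancel by orthogonality, and the diagonal contributes
    the norms [q]. *)
Lemma twisted_mx_unitary (r s : 'I_3 -> gT) (M : 'M[R[i]]_3) :
  coset_representatives H r -> coset_representatives H s ->
  (forall a b,
     M a b = 3%:R^-1 * \sum_i Num.conj (phi i (r a * s b)%g) * G i) ->
  M *m (q^-1 *: (map_mx Num.conj M)^T) = 1%:M.
Proof.
move=> r_reps s_reps ME.
pose D := diag_mx (\row_i G i); pose Dc := diag_mx (\row_i Num.conj (G i)).
have MD : M = 3%:R^-1 *: (conj_phi_mx r *m D *m (conj_phi_mx s)^T).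
  apply/matrixP => a b; rewrite ME mul_mx_diag !mxE; congr (_ * _).
  by apply: eq_bigr => i _; rewrite !mxE extensionM rmorphM /=; ring.
have MDc : (map_mx Num.conj M)^T = 3%:R^-1 *: (phi_mx s *m Dc *m (phi_mx r)^T).
  apply/matrixP => b a; rewrite !mxE ME mul_mx_diag rmorphM fmorphV rmorph_nat.
  congr (_ * _); rewrite rmorph_sum; apply: eq_bigr => i _.
  by rewrite !mxE extensionM !rmorphM /= !conjCK; ring.
have DDc : D *m Dc = q%:M.
  rewrite mulmx_diag -diag_const_mx; congr diag_mx.
  by apply/rowP => i; rewrite !mxE G_norm.
rewrite MDc MD -scalemxAl -!scalemxAr scalerA -!mulmxA.
rewrite [(conj_phi_mx s)^T *m _]mulmxA phi_mx_row_orthogonal //.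
rewrite mul_scalar_mx -scalemxAr [D *m _]mulmxA DDc mul_scalar_mx.
rewrite -!scalemxAr phi_mx_col_orthogonal //.
rewrite !scale_scalar_mx; congr _%:M; field.
exact: q_neq0.
Qed.

End Extensions.

(** * The equivalence for the compressed Fourier matrix *)

Theorem theorem3p2 (R : realType) (F : finFieldType) (p m : nat)
    (p_char : p \in [pchar F]) (card_F : #|F| = (p ^ m)%N)
    (three_dvd : (3 %| #|F| - 1)%N)
    (H : {group {unit F}}) (index_H : #|[set: {unit F}] : H|%g = 3%N)
    (chi : {unit F} -> R[i])
    (chi_char : is_character H chi) (chi_nt : nontrivial_character H chi)
    (phi : 'I_3 -> {unit F} -> R[i])
    (phi_ext : are_three_extensions H chi phi)
    (r s : 'I_3 -> {unit F})
    (r_reps : coset_representatives H r) (s_reps : coset_representatives H s) :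
  nonvanishing_minors (compressed_fourier_matrix p m phi r s) <->
  (exists i j : 'I_3, gauss_sum p m (phi i) != gauss_sum p m (phi j)) /\
  \sum_(i < 3) gauss_sum p m (phi i) != 0.
Proof.
have [phi_char phi_chi phi_inj] := phi_ext.
pose G i := gauss_sum p m (phi i).
have q_neq0 : #|F|%:R != 0 :> R[i].
  by rewrite pnatr_eq0 -lt0n (leq_trans _ (finNzRing_gt1 F)).
have G_norm i : G i * Num.conj (G i) = #|F|%:R.
  apply: gauss_sum_norm => //.
  (* Nontriviality, which the norm formula needs, passes from [chi] to its extensions. *)
  by case: chi_nt => x xH chi_x; exists x; rewrite ?inE // phi_chi.
have entryE a b : compressed_fourier_matrix p m phi r s a b =
    3%:R^-1 * \sum_i Num.conj (phi i (r a * s b)%g) * G i.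
  by rewrite mxE.
set M := compressed_fourier_matrix p m phi r s in entryE *; clearbody M.
have n3 : 3%:R^-1 != 0 :> R[i] by rewrite invr_eq0 pnatr_eq0.
split=> [minM|[G_neq T_neq0]].
- have M_neq0 a b : \sum_i Num.conj (phi i (r a * s b)%g) * G i != 0.
    have := nonvanishing_minors_entry a b minM.
    by rewrite entryE mulf_eq0 (negPf n3).
  (* In column [ord0], row [a] has its argument in [H] and yields that [T0] is nonzero. Any other
     row has its argument outside [H], where equal Gaussian sums would make the entry 0. *)
  have [a aP] := coset_representatives_mul r_reps (s ord0).
  split.
    have [b b_a] : exists b : 'I_3, b != a.
      by exists (lift a ord0); rewrite eq_sym neq_lift.
    have : [exists i, exists j, G i != G j].
      apply: contraT; rewrite negb_exists => /forallP G_eq.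
      have GE i : G i = G ord0.
        have := G_eq i; rewrite negb_exists => /forallP/(_ ord0).
        by rewrite negbK => /eqP.
      case/eqP: (M_neq0 b ord0); under eq_bigr do rewrite GE.
      rewrite -mulr_suml (sum_conj_extensions phi_char phi_chi phi_inj r_reps).
        by rewrite mul0r.
      by rewrite aP.
    by case/existsP => i /existsP[j Gij]; exists i, j.
  have := M_neq0 a ord0; under eq_bigr do rewrite phi_chi ?aP //.
  by rewrite -mulr_sumr mulf_eq0 negb_or => /andP[].
- have M_neq0 a b : M a b != 0.
    rewrite entryE mulf_neq0 //.
    exact: (twisted_sum_neq0 phi_char phi_chi phi_inj q_neq0 G_norm _ r_reps).
  have MN := twisted_mx_unitary phi_char phi_chi phi_inj q_neq0 G_norm
    r_reps s_reps entryE.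
  have [uM _] := mulmx1_unit MN.
  apply: nonvanishing_minors3 => // a b.
  rewrite -[invmx M]mulmx1 -MN mulKmx // !mxE.
  by rewrite mulf_neq0 ?invr_eq0 // conjC_eq0.
Qed.
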